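(* Let $X$ and $Y$ be Polish spaces, let $A$ be a Borel subset of $X\times Y$ with countable vertical sections, and let $k$ be a nonzero natural number. Then the following equivalences hold: (a) $A$ is not $\mathrm{pot}(\mathbf{\Delta}^0_1)$ $\Leftrightarrow$ $A$ is not $\mathrm{pot}(\mathbf{\Sigma}^0_1)$ $\Leftrightarrow$ the projection of $A$ on $Y$ is uncountable. (b) $A$ is not $\mathrm{pot}(\check D_{2k-1}(\mathbf{\Sigma}^0_1))$ $\Leftrightarrow$ $A$ is not $\mathrm{pot}(\check D_{2k}(\mathbf{\Sigma}^0_1))$ $\Leftrightarrow$ $A$ is not $\mathrm{pot}(D_{2k-1}(\mathbf{\Sigma}^0_1)^+)$. (c) $A$ is not $\mathrm{pot}(D_{2k+1}(\mathbf{\Sigma}^0_1))$ $\Leftrightarrow$ $A$ is not $\mathrm{pot}(D_{2k}(\mathbf{\Sigma}^0_1))$ $\Leftrightarrow$ $A$ is not $\mathrm{pot}(D_{2k}(\mathbf{\Sigma}^0_1)^+)$.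
   Context: Wadge classes: a class $\Gamma$ of subsets of zero-dimensional Polish spaces is a Wadge class if there are a zero-dimensional Polish space $P_0$ and a Borel set $A_0\subseteq P_0$ such that for every zero-dimensional Polish space $P$ and every $A\subseteq P$, $A\in\Gamma$ iff there is a continuous $f:P\to P_0$ with $A=f^{-1}(A_0)$. The dual class $\check\Gamma$ is the class of complements of elements of $\Gamma$; $\Gamma$ is non-self-dual if $\Gamma\neq\check\Gamma$. If $\Gamma$ is a non-self-dual Wadge class, $\Gamma^+$ denotes the Wadge class that is the successor of $\Gamma$ for inclusion (the least Wadge class, for inclusion, strictly containing $\Gamma$). Potential classes: if $X,Y$ are Polish, $A\subseteq X\times Y$ is Borel and $\Gamma$ is a Wadge class, then $A$ is $\mathrm{pot}(\Gamma)$ if there are zero-dimensional Polish topologies $\sigma$ on $X$ and $\tau$ on $Y$, finer than the original topologies, such that $A$, viewed as a subset of $(X,\sigma)\times(Y,\tau)$, is in $\Gamma$. For a natural number $m\geq 1$, $D_m(\mathbf{\Sigma}^0_1)$ is the class of sets of the form $\bigcup_{j<m,\ j\text{ of parity opposite to that of }m}U_j\setminus\bigl(\bigcup_{i<j}U_i\bigr)$, where $(U_j)_{j<m}$ is an increasing sequence of open sets; $\check D_m(\mathbf{\Sigma}^0_1)$ is its dual class. The vertical sections of $A$ are the sets $A_x=\{y\in Y:(x,y)\in A\}$, $x\in X$. *)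

(* Defs.v *)
From HB Require Import structures.
From mathcomp Require Import all_boot all_order all_algebra.
From mathcomp Require Import all_classical all_reals all_analysis.

Set Implicit Arguments.
Unset Strict Implicit.
Unset Printing Implicit Defensive.

Local Open Scope classical_set_scope.

(* The metric is not required to be pointed (as in [completePseudoMetricType]),
   so that the empty space is Polish. *)
Definition completely_metrizable (R : realType) (T : topologicalType) : Prop :=
  exists m : Metric R T,
    let M : metricType R := @Metric.Pack R T m in
    @open M = @open T /\
    forall F : set_system M, ProperFilter F -> cauchy F -> exists x : M, F --> x.

Definition separable (T : topologicalType) : Prop :=
  exists2 D : set T, countable D & dense D.

Definition polish (R : realType) (T : topologicalType) : Prop :=
  separable T /\ completely_metrizable R T.

(* Clopen sets form a basis.  The library's [zero_dimensional] only asks that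
   clopen sets separate points, which is weaker, even for Polish spaces. *)
Definition zpolish (R : realType) (T : topologicalType) : Prop :=
  polish R T /\ basis (@clopen T).

Definition borel (T : topologicalType) : set (set T) := <<s @open T >>.

(* Only the values of a class at zero-dimensional Polish spaces are meaningful;
   the values elsewhere are ignored by all the notions below. *)
Definition set_class : Type := forall P : topologicalType, set (set P).

Definition class_sub (R : realType) (G H : set_class) : Prop :=
  forall P : topologicalType, zpolish R P -> G P `<=` H P.

Definition class_ssub (R : realType) (G H : set_class) : Prop :=
  class_sub R G H /\ ~ class_sub R H G.

Definition dual (G : set_class) : set_class := fun P A => G P (~` A).

Definition wadge_class (R : realType) (G : set_class) : Prop :=
  exists (P0 : topologicalType) (A0 : set P0),
    [/\ zpolish R P0, borel A0 &
      forall (P : topologicalType) (A : set P), zpolish R P ->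
        (G P A <-> exists f : P -> P0, continuous f /\ A = f @^-1` A0)].

Definition wadge_successor (R : realType) (G H : set_class) : Prop :=
  [/\ wadge_class R H, class_ssub R G H &
    forall K : set_class, wadge_class R K -> class_ssub R G K ->
      class_sub R H K].

Lemma wadge_successor_unique (R : realType) (G H H' : set_class) :
  wadge_successor R G H -> wadge_successor R G H' ->
  class_sub R H H' /\ class_sub R H' H.
Proof. by move=> [wH GH lH] [wH' GH' lH']; split; [exact: lH|exact: lH']. Qed.

(* Definite description: membership in the successor of G, which is unique by
   the previous lemma. *)
Definition wadge_succ (R : realType) (G : set_class) : set_class := fun P A =>
  exists2 H : set_class, wadge_successor R G H & H P A.

Definition Sigma01 : set_class := fun P A => open A.

Definition Delta01 : set_class := fun P A => clopen A.

Definition Ddiff (m : nat) : set_class := fun P A =>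
  exists U : 'I_m -> set P,
    [/\ forall j : 'I_m, open (U j),
        forall i j : 'I_m, (i <= j)%N -> U i `<=` U j &
        A = \bigcup_(j in [set j : 'I_m | odd j != odd m])
              (U j `\` \bigcup_(i in [set i : 'I_m | (i < j)%N]) U i)].

(* [Topological X] is the type of topologies on the carrier of [X]; the product
   below thus has the same elements as [X * Y]. *)
Definition pot (R : realType) (G : set_class) (X Y : topologicalType)
    (A : set (X * Y)) : Prop :=
  exists (s : Topological X) (t : Topological Y),
    let X' : topologicalType := @Topological.Pack X s in
    let Y' : topologicalType := @Topological.Pack Y t in
    [/\ zpolish R X', @open X `<=` @open X',
        zpolish R Y', @open Y `<=` @open Y' &
        G (X' * Y')%type A].

(* Main.v *)
Require Import Defs.
From HB Require Import structures.
From mathcomp Require Import all_boot all_order all_algebra zify.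
From mathcomp Require Import all_classical all_reals all_analysis.

(* An open subset of [A], for finer topologies, has countable vertical sections,
   so its projection on [Y] is covered by countable basic open sets, hence is
   countable.  A Borel set with countable projection on [Y] can be made clopen
   by refining the two topologies, since this only requires making countably
   many Borel sets of each factor clopen.  This is (a); applied to the first
   open set [U 0] of a sequence witnessing that [A] or its complement is a
   difference of open sets, when [U 0] is included in [A], it allows to merge
   [U 0] into the next term and thus to drop one term of the sequence, which
   gives (b) and (c) as soon as the successor of [D_m] is known to lie between
   [D_m], its dual, [D_(m+1)] and its dual.

   Finer zero-dimensional Polish topologies come from codings of a space by
   integer sequences with closed range and continuous inverse.  The successor of
   [D_m] is computed without determinacy: a set [A] is outside [D_m] iff the
   [m]-th Hausdorff residue of [A] has a point, and around such a point a
   continuous reduction to [A] of any set of the dual class is built by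
   induction on [m]. *)

Set Implicit Arguments.
Unset Strict Implicit.
Unset Printing Implicit Defensive.

Import Order.TTheory GRing.Theory Num.Theory.
Local Open Scope classical_set_scope.
Local Open Scope ring_scope.

(** * Metrics as distance functions *)

Record is_dist (R : realType) (X : Type) (d : X -> X -> R) : Prop := IsDist {
  distxx : forall x, d x x = 0;
  dist_eq0 : forall x y, d x y = 0 -> x = y;
  distC : forall x y, d x y = d y x;
  dist_triangle : forall y x z, d x z <= d x y + d y z }.

Definition dist_open (R : realType) (X : Type) (d : X -> X -> R) (A : set X) :=
  forall x, A x -> exists2 e : R, 0 < e & forall y, d x y < e -> A y.

Definition dist_complete (R : realType) (X : Type) (d : X -> X -> R) :=
  forall F : set_system X, ProperFilter F ->
    (forall e : R, 0 < e -> exists x, F [set y | d x y < e]) ->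
    exists x, forall e : R, 0 < e -> F [set y | d x y < e].

Section dist_space.
Context (R : realType) (X : Type) (d : X -> X -> R) (hd : is_dist d).

(** A copy of [X] that carries [hd], so that the metric instance can depend on the distance. *)
Definition dist_space & is_dist d := X.
Local Notation M := (dist_space hd).

HB.instance Definition _ := gen_eqMixin M.
HB.instance Definition _ := gen_choiceMixin M.
HB.instance Definition _ := @isMetric.Build R M d
  (distxx hd) (dist_eq0 hd) (distC hd) (dist_triangle hd).

End dist_space.

Lemma metric_openP (R : realType) (M : metricType R) (A : set M) :
  open A <-> dist_open (@mdist R M) A.
Proof.
rewrite openE; split=> AO x Ax.
  by have /nbhs_ballP[e e0 eA] := AO x Ax; exists e => // y xy; apply: eA;
    rewrite ballEmdist.
have [e e0 eA] := AO x Ax; apply/nbhs_ballP; exists e => // y.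
by rewrite ballEmdist; exact: eA.
Qed.

Lemma metric_is_dist (R : realType) (M : metricType R) :
  is_dist (@mdist R M).
Proof.
split; [exact: mdistxx|exact: mdist_positivity|exact: metric_sym|].
by move=> y x z; exact: metric_triangle.
Qed.

Lemma metric_completeP (R : realType) (M : metricType R) :
  (forall F : set_system M, ProperFilter F -> cauchy F ->
     exists x : M, F --> x) <-> dist_complete (@mdist R M).
Proof.
split=> cM F PF FC.
  have [|x Fx] := cM F PF.
    by apply: cauchy_exP => e e0; have [x Fx] := FC e e0; exists x;
      rewrite ballEmdist.
  by exists x => e e0; rewrite -ballEmdist; apply: Fx; exact: nbhsx_ballx.
have [|x Fx] := cM F PF.
  move=> e e0; have /cauchyP/(_ e e0)[x] := FC.
  by rewrite ballEmdist => ?; exists x.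
exists x => A /nbhs_ballP[e e0]; rewrite ballEmdist => eA.
exact: filterS eA (Fx e e0).
Qed.

Lemma completely_metrizableP (R : realType) (T : topologicalType) :
  completely_metrizable R T <->
  exists d : T -> T -> R,
    [/\ is_dist d, @open T = dist_open d & dist_complete d].
Proof.
split=> [[m [oE cM]]|[d [hd oE cd]]].
  pose M := @Metric.Pack R T m; exists (@mdist R M); split.
  - exact: (@metric_is_dist R M).
  - by rewrite -oE; apply/funext => A; apply/propext; exact: (@metric_openP R M).
  - exact/(@metric_completeP R M).
exists (Metric.class (dist_space hd)); split.
  by rewrite oE; apply/funext => A; apply/propext; exact: metric_openP.
exact/(@metric_completeP R (dist_space hd)).
Qed.

Lemma dist_topology (R : realType) (X : Type) (d : X -> X -> R) :
  is_dist d -> exists s : Topological X,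
    @open (@Topological.Pack X s) = dist_open d.
Proof.
move=> hd; exists (Topological.class (dist_space hd)).
by apply/funext => A; apply/propext; exact: (@metric_openP R (dist_space hd)).
Qed.

(** * Topologies coded by integer sequences *)

(* [phi] codes [X] by points of [nat ^ I]: [chart_open phi] is the topology
   pulled back from the product, and [chart_complete phi] says that the range of
   [phi] is closed. *)
Definition chart_open (X : Type) (I : eqType) (phi : X -> I -> nat) (A : set X) :=
  forall x, A x -> exists s : seq I, forall y, {in s, phi x =1 phi y} -> A y.

Definition chart_complete (X : Type) (I : eqType) (phi : X -> I -> nat) :=
  forall z : I -> nat, (forall s : seq I, exists x, {in s, phi x =1 z}) ->
    exists x, phi x =1 z.

Lemma invS_lt (R : realType) (e : R) : 0 < e -> exists k : nat, k.+1%:R^-1 < e.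
Proof. by move=> /ltr_add_invr[k]; rewrite add0r; exists k. Qed.

Lemma countable_option_image (I X : Type) (f : I -> option X) :
  countable [set: I] -> countable [set x | exists i, f i = Some x].
Proof.
move=> cI; have : countable (some @` [set x | exists i, f i = Some x]).
  apply: (@sub_countable _ _ _ [set f i | i in setT]).
    by apply: subset_card_le => _ [x [i fi] <-]; exists i.
  by apply: sub_countable (card_image_le _ _) cI.
move=> /countable_injP[g gI]; apply/countable_injP; exists (g \o some).
move=> x y /set_mem Dx /set_mem Dy gxy.
by apply: Some_inj; apply: gI gxy; rewrite inE; [exists x|exists y].
Qed.

Section chart_dist.
Context (R : realType) (X : Type) (phi : X -> nat -> nat).
Context (phi_inj : forall x y, phi x =1 phi y -> x = y).

(** The usual ultrametric of the Baire space, pulled back along [phi]. *)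
Let dist (x y : X) : R :=
  if pselect (exists n, phi x n != phi y n) is left h
  then (ex_minn h).+1%:R^-1 else 0.

Let distP x y n : reflect (forall k, (k <= n)%N -> phi x k = phi y k)
                          (dist x y < n.+1%:R^-1).
Proof.
rewrite /dist; case: pselect => [h|h]; last first.
  rewrite invr_gt0 ltr0n; apply: ReflectT => k _; apply/eqP; apply: contrapT.
  by move=> /negP ?; apply: h; exists k.
case: ex_minnP => m xym hm; rewrite ltf_pV2 ?posrE ?ltr0n// ltr_nat ltnS.
apply: (iffP idP) => [nm k kn|nxy].
  apply/eqP; apply: contraTT (leq_ltn_trans kn nm) => /hm.
  by rewrite -leqNgt.
by rewrite ltnNge; apply: contra xym => /nxy ->.
Qed.

Let dist_ge0 x y : 0 <= dist x y.
Proof. by rewrite /dist; case: pselect => // h; rewrite invr_ge0. Qed.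

Let dist_exact x y : dist x y != 0 ->
  exists2 n, phi x n != phi y n & dist x y = n.+1%:R^-1.
Proof.
rewrite /dist; case: pselect => [h _|]; last by rewrite eqxx.
by case: ex_minnP => m xym _; exists m.
Qed.

Let dist_is_dist : is_dist dist.
Proof.
have dC x y : dist x y <= dist y x.
  have [->|/dist_exact[n xyn ->]] := eqVneq (dist x y) 0; first exact: dist_ge0.
  rewrite leNgt; apply/negP => /distP/(_ n (leqnn _)) E.
  by rewrite E eqxx in xyn.
split=> [x|x y xy|x y|y x z].
- by apply/eqP; apply: contrapT => /negP/dist_exact[n]; rewrite eqxx.
- apply: phi_inj => n; have := @distP x y n.
  by rewrite xy invr_gt0 ltr0n => /elimT; exact.
- by apply/eqP; rewrite eq_le !dC.
- have [->|/dist_exact[n xyn ->]] := eqVneq (dist x z) 0.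
    exact: addr_ge0.
  rewrite leNgt; apply/negP => h; move/negP: xyn; apply.
  have /distP/(_ n (leqnn _)) -> : dist x y < n.+1%:R^-1.
    by apply: le_lt_trans h; rewrite lerDl.
  have /distP/(_ n (leqnn _)) -> // : dist y z < n.+1%:R^-1.
  by apply: le_lt_trans h; rewrite lerDr.
Qed.

Let dist_openE : dist_open dist = chart_open phi.
Proof.
apply/funext => A; apply/propext; split=> AO x Ax; have := AO x Ax.
  move=> [e e0 eA]; have [k ke] := invS_lt e0.
  exists (iota 0 k.+1) => y xy; apply: eA; apply: lt_trans ke; apply/distP.
  by move=> i ik; apply: xy; rewrite mem_iota/= add0n ltnS.
move=> [s sA]; exists (\max_(i <- s) i).+1%:R^-1; first by rewrite invr_gt0.
by move=> y /distP xy; apply: sA => i /= si; apply: xy; exact: leq_bigmax_seq.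
Qed.

Let cylinder x n := [set y | forall k, (k <= n)%N -> phi x k = phi y k].

Let cylinder_clopen x n :
  chart_open phi (cylinder x n) /\ chart_open phi (~` cylinder x n).
Proof.
split=> [y xy|y xy]; exists (iota 0 n.+1) => z yz.
  move=> k kn; rewrite xy//.
  by apply: yz; rewrite mem_iota/= add0n ltnS.
move=> xz; apply: xy => k kn; rewrite xz//; apply/esym.
by apply: yz; rewrite mem_iota/= add0n ltnS.
Qed.

Let cylinder_sub (x : X) (s : seq nat) (y : X) :
  cylinder x (\max_(i <- s) i) y -> {in s, phi x =1 phi y}.
Proof. by move=> xy i si; apply: xy; exact: leq_bigmax_seq. Qed.

Let dist_complete_ : chart_complete phi -> dist_complete dist.
Proof.
move=> cphi F PF FC.
(* Coordinate [n] of the limit code is read off a cylinder of [F]; every finite part of that code is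
   then realised on a set of [F]. *)
have cyl n : exists x, F (cylinder x n).
  have [|x Fx] := FC n.+1%:R^-1; first by rewrite invr_gt0.
  by exists x; apply: filterS Fx => y /distP.
have [u uF] := choice cyl.
have Fz (s : seq nat) : F [set y | {in s, phi y =1 fun n => phi (u n) n}].
  elim: s => [|n s IHs]; first by apply: filterE => y i; rewrite in_nil.
  apply: filterS (filterI (uF n) IHs) => y [ny sy] i.
  rewrite inE => /predU1P[->|]; last exact: sy.
  by rewrite -ny.
have [s|x xz] := cphi (fun n => phi (u n) n).
  by have /filter_ex[x] := Fz s; exists x.
exists x => e /invS_lt[n ne]; apply: filterS (Fz (iota 0 n.+1)) => y yz /=.
apply: lt_trans ne; apply/distP => k kn.
by rewrite xz yz// mem_iota/= add0n ltnS.
Qed.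

(** [phi] identifies [X] with a closed subset of the Baire space. *)
Lemma nat_chart_zpolish : chart_complete phi ->
  exists s : Topological X, let X' := @Topological.Pack X s in
    zpolish R X' /\ @open X' = chart_open phi.
Proof.
move=> cphi; have [s] := dist_topology dist_is_dist.
rewrite dist_openE => oE; exists s; split => //; split; last first.
  split=> [U []//|x A]; rewrite nbhsE => -[B [oB Bx] BA].
  move: oB; rewrite oE => /(_ x Bx)[t tB].
  exists (cylinder x (\max_(i <- t) i)).
    split; last by move=> k _.
    by split; rewrite -?openC/= oE; have [] := cylinder_clopen x (\max_(i <- t) i).
  by move=> y /cylinder_sub/tB/BA.
split; last first.
  apply/completely_metrizableP; exists dist; split => //; last exact: dist_complete_.
  by rewrite oE dist_openE.
(* Separability: one point is chosen for each finite prefix realised in [X]. *)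
pose meets (p : seq nat) :=
  exists x, forall k, (k < size p)%N -> phi x k = nth 0%N p k.
pose f p := if pselect (meets p) is left h then Some (projT1 (cid h)) else None.
exists [set x | exists p, f p = Some x].
  exact: countable_option_image (countableP _).
move=> O [x Ox]; rewrite oE => /(_ x Ox)[s0 sO].
pose n := (\max_(i <- s0) i)%N; pose p := mkseq (phi x) n.+1.
have h : meets p by exists x => k; rewrite size_mkseq => kn; rewrite nth_mkseq.
exists (projT1 (cid h)); split; last first.
  by exists p; rewrite /f; case: pselect => // h'; rewrite (Prop_irrelevance h h').
case: cid => y yp; rewrite [projT1 _]/=; apply/sO/cylinder_sub => k kn.
have {}kn : (k < n.+1)%N by [].
have kp : (k < size p)%N by rewrite size_mkseq.
by rewrite (yp k kp) /p nth_mkseq.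
Qed.

End chart_dist.

Lemma chart_zpolish (R : realType) (X : Type) (I : countType)
    (phi : X -> I -> nat) :
  (forall x y, phi x =1 phi y -> x = y) -> chart_complete phi ->
  exists s : Topological X, let X' := @Topological.Pack X s in
    zpolish R X' /\ @open X' = chart_open phi.
Proof.
move=> phi_inj cphi.
(* Indices are transported along [pickle]; the value 0 is left to integers that code no index. *)
pose psi x n := if @pickle_inv I n is Some i then (phi x i).+1 else 0%N.
have psiE x i : psi x (pickle i) = (phi x i).+1 by rewrite /psi pickleK_inv.
have psi_eq x y n : (forall i, pickle i = n -> phi x i = phi y i) ->
    psi x n = psi y n.
  rewrite /psi; have := @pickle_invK I n.
  by case: pickle_inv => //= i ii -> .
have [x y xy|z zs|s [zs oE]] := @nat_chart_zpolish R X psi.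
- by apply: phi_inj => i; apply: succn_inj; rewrite -!psiE xy.
- have [s|x xz] := cphi (fun i => (z (pickle i)).-1).
    have [x xz] := zs [seq pickle i | i <- s]; exists x => i si.
    by rewrite -xz ?psiE// map_f.
  exists x => n; have [y /(_ n (mem_head _ _)) yn] := zs [:: n].
  by rewrite -yn; apply: psi_eq => i ni; rewrite xz ni -yn -ni psiE.
exists s; split => //; rewrite oE; apply/funext => A; apply/propext.
split=> AO x /AO[t tA].
  exists (pmap (@pickle_inv I) t) => y xy; apply: tA => n tn; apply: psi_eq.
  move=> i ni; apply: xy; rewrite mem_pmap; apply/mapP; exists n => //.
  by rewrite -ni pickleK_inv.
exists [seq pickle i | i <- t] => y xy; apply: tA => i ti.
by apply: succn_inj; rewrite -!psiE xy// map_f.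
Qed.

Lemma completely_metrizable_hausdorff (R : realType) (T : topologicalType) :
  completely_metrizable R T -> hausdorff_space T.
Proof.
move=> [m [oE _]] x y xy; apply: (@metric_hausdorff R (@Metric.Pack R T m)).
move=> A B; rewrite !nbhsE -/open => -[U [oU Ux] UA] [V [oV Vy] VB].
have [||z [Uz Vz]] := xy U V; last by exists z; split; [exact: UA|exact: VB].
- by apply: open_nbhs_nbhs; split; rewrite // -oE.
- by apply: open_nbhs_nbhs; split; rewrite // -oE.
Qed.

(* 0 when no [n] satisfies [P], and otherwise 1 + the least such [n]. *)
Definition first (P : nat -> Prop) : nat :=
  if pselect (exists n, `[< P n >]) is left h then (ex_minn h).+1 else 0%N.

Variant first_spec (P : nat -> Prop) : nat -> Prop :=
| FirstNone of (forall n, ~ P n) : first_spec P 0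
| FirstSome n of P n & (forall k, (k < n)%N -> ~ P k) : first_spec P n.+1.

Lemma firstP P : first_spec P (first P).
Proof.
rewrite /first; case: pselect => [h|h].
  case: ex_minnP => n /asboolP Pn hn; constructor => // k kn /asboolP/hn.
  by rewrite leqNgt kn.
by constructor => n Pn; apply: h; exists n; exact/asboolP.
Qed.

Lemma first_unique P n : P n -> (forall k, (k < n)%N -> ~ P k) -> first P = n.+1.
Proof.
move=> Pn hn; case: firstP => [/(_ n)//|m Pm hm]; congr _.+1; apply/eqP.
rewrite eqn_leq; apply/andP.
by split; rewrite leqNgt; apply/negP; [move/hm|move/hn]; exact.
Qed.

(** As [first P] is one plus the least index, the hypothesis covers that index too; the value thus
    depends on finitely many instances. *)
Lemma eq_first P Q :
  (exists n, P n) -> (forall k, (k < first P)%N -> P k <-> Q k) ->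
  first Q = first P.
Proof.
move=> [m Pm]; case: firstP => [/(_ m)//|n Pn hn] PQ.
apply: first_unique; first exact/PQ.
by move=> k kn /PQ Pk; apply: (hn k kn); apply: Pk; exact: ltnW.
Qed.

(** The coded topology is only asked to refine that of [T], which leaves room to make more sets
    open. *)
Definition chart (T : topologicalType) (I : eqType) (phi : T -> I -> nat) :=
  @open T `<=` chart_open phi /\ chart_complete phi.

Section charts.
Context (T : topologicalType).

Lemma chart_inj (I : eqType) (phi : T -> I -> nat) :
  hausdorff_space T -> chart phi -> forall x y, phi x =1 phi y -> x = y.
Proof.
move=> hT [fine _] x y xy; apply: contrapT => /eqP nxy.
move: hT; rewrite open_hausdorff => /(_ _ _ nxy)[[U V]] /=; rewrite !inE.
move=> [Ux Vy] [/fine oU _ UV]; have [s sU] := oU x Ux.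
have : (U `&` V) y by split => //; apply: sU => i _.
by rewrite UV.
Qed.

(** Each chart yields its own limit point. These points coincide because the space is Hausdorff and
    a single element approximates any two of them at once. *)
Lemma chart_join (I : nat -> countType) (phi : forall n, T -> I n -> nat) :
  hausdorff_space T -> (forall n, chart (phi n)) ->
  chart (fun x (i : {n & I n}) => phi (tag i) x (tagged i)).
Proof.
move=> hT cphi; split=> [U oU x Ux|z zs].
  have [s sU] := (cphi 0%N).1 U oU x Ux.
  exists [seq Tagged I i | i <- s] => y xy; apply: sU => i si.
  exact: (xy (Tagged I i) (map_f _ si)).
have lim n : exists x, phi n x =1 fun i => z (Tagged I i).
  apply: (cphi n).2 => s; have [x xz] := zs [seq Tagged I i | i <- s].
  by exists x => i si; exact: (xz (Tagged I i) (map_f _ si)).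
have [u uz] := choice lim.
have uE n : u n = u 0%N.
  apply: contrapT => /eqP nu; move: hT; rewrite open_hausdorff => /(_ _ _ nu)[[U V]] /=.
  rewrite !inE => -[Un V0] [oU oV UV].
  have [s sU] := (cphi n).1 U oU _ Un; have [t tV] := (cphi 0%N).1 V oV _ V0.
  have [x xz] := zs ([seq Tagged I i | i <- s] ++ [seq Tagged I i | i <- t]).
  have : (U `&` V) x; last by rewrite UV.
  split; [apply: sU|apply: tV] => i ii; rewrite uz;
    apply/esym/(xz (Tagged I i)); rewrite mem_cat map_f ?orbT//.
by exists (u 0%N) => -[n i] /=; rewrite -(uE n) uz.
Qed.

(** There are countably many cylinders; [D n] is the one coded by [n] if it lies inside [A], and is
    empty otherwise. *)
Lemma chart_open_bigcup (I : countType) (phi : T -> I -> nat) (A : set T) :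
  chart_open phi A -> exists D : nat -> set T, A = \bigcup_n D n /\
    forall n, exists s : seq I, forall x y, {in s, phi x =1 phi y} ->
      D n x -> D n y.
Proof.
move=> oA.
pose cyl (c : seq (I * nat)) := [set x | forall p, p \in c -> phi x p.1 = p.2].
exists (fun n => [set x | exists2 c : seq (I * nat),
  pickle c = n & cyl c x /\ cyl c `<=` A]); split=> [|n].
  apply/seteqP; split=> [x Ax|x [n _ [c _ []]]]; last by move=> /[swap]; exact.
  have [s sA] := oA x Ax; pose c := [seq (i, phi x i) | i <- s].
  exists (pickle c) => //; exists c => //; split; first by move=> _ /mapP[i _ ->].
  by move=> y cy; apply: sA => i si; rewrite (cy (i, phi x i))// map_f.
have [[c nc]|nc] := pselect (exists c : seq (I * nat), pickle c = n).
  exists [seq p.1 | p <- c] => x y xy [c' c'n [cx cA]]; exists c' => //.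
  split=> // p pc; rewrite -xy ?cx//; apply: map_f.
  by rewrite (pcan_inj pickleK (etrans nc (esym c'n))).
by exists [::] => x y _ [c cn]; case: nc; exists c.
Qed.

(** The new coordinate [None] records the first [D n] containing the point, hence decides membership
    in [A]. Since each [D n] depends on finitely many old coordinates, the range of codes stays
    closed. *)
Lemma chart_clopen (I : countType) (phi : T -> I -> nat) (A : set T) :
  chart phi -> chart_open phi A ->
  exists psi : T -> option I -> nat,
    [/\ chart psi, chart_open psi A & chart_open psi (~` A)].
Proof.
move=> [fphi cphi] oA; have [D [AE Ds]] := chart_open_bigcup oA.
have [s sD] := choice Ds.
pose psi x i := if i is Some j then phi x j else first (D ^~ x).
have oD x y : {in [:: None], psi x =1 psi y} -> A x -> A y.
  move=> /(_ None (mem_head _ _)) /=; rewrite AE => + [n _ Dx].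
  case: firstP => [/(_ n)//|m Dm _]; case: firstP => // k Dk _ _.
  by exists k.
exists psi; split; last 2 first.
- by move=> x Ax; exists [:: None] => y /oD; exact.
- move=> x Ax; exists [:: None] => y xy Ay; apply: Ax; apply: oD Ay => i si.
  by rewrite xy.
split=> [U /fphi oU x /oU[t tU]|z zs].
  exists [seq Some i | i <- t] => y xy; apply: tU => i ti.
  exact: (xy (Some i) (map_f _ ti)).
have [t|x xz] := cphi (z \o Some).
  have [x xz] := zs [seq Some i | i <- t]; exists x => i ti.
  exact: (xz (Some i) (map_f _ ti)).
have near (t : seq I) : exists y, first (D ^~ y) = z None /\ {in t, phi x =1 phi y}.
  have [y yz] := zs (None :: [seq Some i | i <- t]); exists y.
  split=> [|i ti]; first by rewrite -yz ?mem_head.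
  by rewrite xz; apply/esym/(yz (Some i)); rewrite inE map_f.
exists x => -[i|] /=; first exact: xz.
have [[n Dx]|nD] := pselect (exists n, D n x).
  have [y [<- xy]] := near (flatten [seq s k | k <- iota 0 (first (D ^~ x))]).
  apply/esym/eq_first; first by exists n.
  move=> k kn; have sk i : i \in s k -> phi x i = phi y i.
    move=> ik; apply: xy; apply/flatten_mapP; exists k => //.
    by rewrite mem_iota.
  by split; apply: sD => // i /sk.
(* [(z None).-1] is the index announced by [z]: if there were one, [y] and therefore [x] would be in
   that [D n]. *)
have [y [yz xy]] := near (s (z None).-1).
case: (firstP (D ^~ x)) => [_|n Dn]; last by case: nD; exists n.
rewrite -yz; case: firstP yz => // n Dn _ nz; case: nD; exists n.
by apply: (sD n y x) Dn => i si; rewrite xy// -nz.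
Qed.

End charts.

(** * Charts of Polish spaces, and refinements that make Borel sets clopen *)

Lemma dist_open_ball (R : realType) (X : Type) (d : X -> X -> R) x (e : R) :
  is_dist d -> dist_open d [set y | d x y < e].
Proof.
move=> hd y /= xy; exists (e - d x y); first by rewrite subr_gt0.
move=> z yz; apply: (le_lt_trans (dist_triangle hd y x z)).
by rewrite -ltrBrDl.
Qed.

(** The basis consists of balls around the points of a countable dense set; index 0 holds the whole
    space, as a starting point for shrinking. *)
Lemma separable_regular_basis (R : realType) (T : topologicalType)
    (d : T -> T -> R) :
  separable T -> is_dist d -> @open T = dist_open d ->
  exists W : nat -> set T, [/\ W 0%N = setT, forall n, open (W n) &
    forall (e : R) (x : T) (U : set T), 0 < e -> open U -> U x ->
    exists l, [/\ W l x, closure (W l) `<=` U &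
      forall y z, W l y -> W l z -> d y z < e]].
Proof.
move=> [D /countable_injP[f fI] dD] hd oE.
pose ball q (b : nat) := [set x | d q x < b.+1%:R^-1].
have oball q b : open (ball q b) by rewrite oE; exact: dist_open_ball.
(* The union has at most one term, as [f] is injective on [D]: it merely decodes [k]. *)
pose W n := if n is k.+1 then \bigcup_(p in [set p : T * nat |
  D p.1 /\ pickle (f p.1, p.2) = k]) ball p.1 p.2 else setT.
have OE q b : D q -> W (pickle (f q, b)).+1 = ball q b.
  move=> Dq; apply/seteqP; split=> [x [[q' b'] /= [Dq' qq']]|x]; last by exists (q, b).
  have [fq' ->] : (f q', b') = (f q, b) by exact: (pcan_inj pickleK).
  by have -> : q' = q by apply: fI fq'; rewrite inE.
exists W; split=> // [[|n]|e x U e0 oU Ux]; first exact: openT.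
  exact: bigcup_open.
move: (oU); rewrite oE => /(_ x Ux)[r r0 rU].
(* Three radii lead from [x] to a point of the closure: to the center, to a point of the ball, then
   to the given point. Two bound the diameter. *)
have [b hb] : exists b : nat, b.+1%:R^-1 < Num.min r e / 3.
  by apply: invS_lt; rewrite divr_gt0// lt_min r0.
have b0 : 0 < b.+1%:R^-1 :> R by rewrite invr_gt0.
have [q [xq Dq]] : [set y | d x y < b.+1%:R^-1] `&` D !=set0.
  apply: dD; first by exists x => /=; rewrite (distxx hd).
  by rewrite oE; exact: dist_open_ball.
have {}hb : b.+1%:R^-1 *+ 3 < Num.min r e.
  by rewrite -[_ *+ 3]mulr_natr -ltr_pdivlMr.
have [hr he] : b.+1%:R^-1 *+ 3 < r /\ b.+1%:R^-1 *+ 3 < e.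
  by move: hb; rewrite lt_min => /andP.
exists (pickle (f q, b)).+1; rewrite OE//; split=> [|y|y z].
- by rewrite /ball/= (distC hd).
- move=> /(_ [set z | d y z < b.+1%:R^-1])[|z [/= qz yz]].
    apply: open_nbhs_nbhs; split; first by rewrite oE; exact: dist_open_ball.
    by rewrite /= (distxx hd).
  apply: rU; apply: lt_trans hr.
  apply: (le_lt_trans (dist_triangle hd q x y)).
  rewrite mulrSr mulr2n -addrA ltrD//.
  apply: (le_lt_trans (dist_triangle hd z q y)); rewrite ltrD//.
  by rewrite (distC hd).
- rewrite /ball/= => qy qz; apply: lt_trans he.
  apply: (le_lt_trans (dist_triangle hd q y z)); rewrite (distC hd y).
  by rewrite mulrSr mulr2n -addrA ltrD// ltr_pwDr// ltW.
Qed.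

(* The coordinates of [x] record which basic sets [W j] contain [x], and, for
   each [n] and each such [j], the first basic set around [x] of diameter less
   than [1 / (n + 1)] whose closure is included in [W j].  The former determine
   the latter, and the latter make the set of codes closed. *)
Lemma polish_chart (R : realType) (T : topologicalType) : polish R T ->
  exists (I : countType) (phi : T -> I -> nat), chart phi.
Proof.
move=> [sT /completely_metrizableP[d [hd oE cd]]].
have [W [OT oO Ob]] := separable_regular_basis sT hd oE.
pose small n l := forall y z, W l y -> W l z -> d y z < n.+1%:R^-1.
pose wit (n j : nat) x l := [/\ W l x, closure (W l) `<=` W j & small n l].
pose phi x (i : nat + nat * nat) : nat := match i with
  | inl j => `[< W j x >] : nat
  | inr (n, j) => first (wit n j x) end.
have witO n j x : W j x -> exists l, wit n j x l.
  by move=> Ojx; apply: Ob => //; rewrite invr_gt0.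
have phi_l x y j : phi x (inl j) = phi y (inl j) -> W j x -> W j y.
  by rewrite /phi; case: asboolP => // ?; case: asboolP.
exists (nat + nat * nat)%type, phi; split=> [U oU x Ux|z zs].
  have [l [Olx OlU _]] := Ob 1 x U ltr01 oU Ux.
  exists [:: inl l] => y xy; apply: OlU; apply: subset_closure.
  by apply: phi_l Olx; exact/xy/mem_head.
(* [F] is generated by the sets of points that match [z] on finitely many coordinates; its limit
   will be the point coded by [z]. *)
pose F := [set A : set T | exists s : seq (nat + nat * nat),
  forall x, {in s, phi x =1 z} -> A x].
have FF : ProperFilter F.
  split; first by move=> [s sF]; have [x /sF] := zs s.
  split=> [|A B [s sA] [t tB]|A B AB [s sA]].
  - by exists [::].
  - exists (s ++ t) => x xz; split; [apply: sA|apply: tB] => i ii;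
      by apply: xz; rewrite mem_cat ii ?orbT.
  - by exists s => x /sA/AB.
have FO n j : F (W j) -> exists2 l, F (W l) & closure (W l) `<=` W j /\ small n l.
  move=> [s sO]; have [x xz] := zs (inr (n, j) :: s).
  have Ojx : W j x by apply: sO => i si; apply: xz; rewrite inE si orbT.
  have zE : z (inr (n, j)) = first (wit n j x) by rewrite -xz ?mem_head.
  move: zE; case: firstP => [nw|l [_ cl sl] _ zE].
    by have [l /nw] := witO n j x Ojx.
  exists l => //; exists [:: inr (n, j)] => y /(_ _ (mem_head _ _)) /=.
  by rewrite zE; case: firstP => // l' [Oly _ _] _ [<-].
have [e e0|x Fx] := cd F FF.
  (* [W 0] is the whole space, hence in [F], and [FO] shrinks it to a set of small diameter. *)
  have [n ne] := invS_lt e0; have [|l [s sO] [_ sl]] := FO n 0%N.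
    by rewrite OT; exact: filterT.
  have [x xz] := zs s; exists x; exists s => y yz /=.
  by apply: lt_trans ne; apply: sl; exact: sO.
have FU U : open U -> U x -> F U.
  by rewrite oE => oU /oU[e e0 eU]; apply: filterS eU (Fx e e0).
have FC j : F (W j) -> closure (W j) x.
  move=> FOj U; rewrite nbhsE => -[V [oV Vx] VU].
  have [y [Vy Ojy]] := filter_ex (filterI (FU V oV Vx) FOj).
  by exists y; split => //; exact: VU.
(* If [W j] is in [F], so is a basic set whose closure lies inside [W j]; the limit [x] belongs to
   that closure. *)
have xl j : phi x (inl j) = z (inl j).
  have [Ojx|nOjx] := pselect (W j x).
    have [s sO] := FU _ (oO j) Ojx.
    have [y yz] := zs (inl j :: s); rewrite -yz ?mem_head//=.
    rewrite !asboolT//; apply: sO => i si.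
    by apply: yz; rewrite inE si orbT.
  have [y yz] := zs [:: inl j]; rewrite -yz ?mem_head//=.
  rewrite !asboolF// => Ojy; apply: nOjx.
  have [|l /FC + [+ _]] := FO 0%N j; last by move=> /[swap]; exact.
  exists [:: inl j] => y' y'z; apply: phi_l Ojy.
  by rewrite y'z ?yz ?mem_head.
exists x => -[j|[n j]]; first exact: xl.
(* [x] and [y] agree on membership in [W j] and in every basic set up to the first witness at [x];
   this membership is the only part of [wit] that depends on the point. *)
have [y yz] :=
  zs [:: inr (n, j), inl j & [seq inl k | k <- iota 0 (first (wit n j x))]].
have xyj : phi x (inl j) = phi y (inl j) by rewrite xl yz// !inE eqxx orbT.
rewrite -yz ?mem_head//=; have [Ojx|nOjx] := pselect (W j x).
  apply/esym/eq_first; first exact: witO.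
  move=> k kn; have xyk : phi x (inl k) = phi y (inl k).
    by rewrite xl yz// !inE map_f ?orbT// mem_iota.
  by split=> -[Ok ? ?]; split => //; apply: phi_l Ok.
case: firstP => [_|l [Olx cl _]]; last first.
  by case: nOjx; apply: cl; exact: subset_closure.
case: firstP => // l [Oly cl _]; case: nOjx; apply: (phi_l y x) => //.
by apply: cl; exact: subset_closure.
Qed.

(** The sets made clopen by some chart form a sigma-algebra: joining the charts of the terms makes a
    union open, and one more coordinate makes it clopen. *)
Lemma borel_chart (R : realType) (T : topologicalType) (B : set T) :
  polish R T -> borel B ->
  exists (I : countType) (phi : T -> I -> nat),
    [/\ chart phi, chart_open phi B & chart_open phi (~` B)].
Proof.
move=> pT; pose good (A : set T) := exists (I : countType) (phi : T -> I -> nat),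
  [/\ chart phi, chart_open phi A & chart_open phi (~` A)].
have hT : hausdorff_space T by exact: completely_metrizable_hausdorff pT.2.
have good_open A : open A -> good A.
  move=> oA; have [I [phi cphi]] := polish_chart pT.
  by have [psi hpsi] := chart_clopen cphi (cphi.1 _ oA); exists (option I), psi.
suff : @borel T `<=` good by exact.
apply: (smallest_sub _ good_open); split=> [|A [I [phi [? ? ?]]]|A gA].
- exact/good_open/open0.
- by exists I, phi; rewrite setTD setCK.
- have /choice[Iphi IphiP] n : exists Iphi : {I : countType & T -> I -> nat},
      let phi := projT2 Iphi in
      [/\ chart phi, chart_open phi (A n) & chart_open phi (~` A n)].
    by have [I [phi ?]] := gA n; exists (existT _ I phi).
  have cI n : chart (projT2 (Iphi n)) by have [] := IphiP n.
have cJ := chart_join hT cI.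
  have [|psi hpsi] := chart_clopen cJ (A := \bigcup_n A n).
    move=> x [n _ Anx]; have [_ /(_ x Anx)[s sA] _] := IphiP n.
    exists [seq Tagged (fun n => projT1 (Iphi n)) i | i <- s] => y xy; exists n => //.
    apply: sA => i si.
    exact: (xy (Tagged (fun n => projT1 (Iphi n)) i) (map_f _ si)).
  by exists (option {n & projT1 (Iphi n)}), psi.
Qed.

Lemma zpolish_refinement (R : realType) (T : topologicalType) (B : nat -> set T) :
  polish R T -> (forall n, borel (B n)) ->
  exists s : Topological T, let T' := @Topological.Pack T s in
    [/\ zpolish R T', @open T `<=` @open T' & forall n, @clopen T' (B n)].
Proof.
move=> pT bB.
have hT : hausdorff_space T by exact: completely_metrizable_hausdorff pT.2.
have /choice[Iphi IphiP] n : exists Iphi : {I : countType & T -> I -> nat},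
    let phi := projT2 Iphi in
    [/\ chart phi, chart_open phi (B n) & chart_open phi (~` B n)].
  by have [I [phi ?]] := borel_chart pT (bB n); exists (existT _ I phi).
have cI n : chart (projT2 (Iphi n)) by have [] := IphiP n.
have cJ := chart_join hT cI.
have [s [zs oE]] := chart_zpolish R (chart_inj hT cJ) cJ.2.
exists s; split => // [|n]; first by rewrite oE; exact: cJ.1.
have [_ oB oCB] := IphiP n.
by split; rewrite -?openC/= oE => x Ax;
  [have [t tA] := oB x Ax|have [t tA] := oCB x Ax];
  exists [seq Tagged (fun n => projT1 (Iphi n)) i | i <- t] => y xy;
  apply: tA => i ti; exact: (xy (Tagged (fun n => projT1 (Iphi n)) i) (map_f _ ti)).
Qed.

(** * Products and countable projections *)

Lemma open_prodP (S T : topologicalType) (A : set (S * T)) :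
  open A <-> forall x y, A (x, y) -> exists U V,
    [/\ open U, open V, U x, V y & U `*` V `<=` A].
Proof.
rewrite openE; split=> AO.
  move=> x y /AO[[P Q]] /=; rewrite !nbhsE.
  move=> [[U [oU Ux] UP] [V [oV Vy] VQ]] PQA; exists U, V; split => //.
  by move=> [a b] [/= /UP Pa /VQ Qb]; apply: PQA.
move=> [x y] /AO[U [V [oU oV Ux Vy] UVA]]; exists (U, V) => //=.
by split; apply: open_nbhs_nbhs.
Qed.

Lemma open_prod_finer (X Y : topologicalType) (s : Topological X)
    (t : Topological Y) (A : set (X * Y)) :
  let X' := @Topological.Pack X s in let Y' := @Topological.Pack Y t in
  @open X `<=` @open X' -> @open Y `<=` @open Y' ->
  open A -> @open (X' * Y')%type A.
Proof.
move=> X' Y' fX fY /open_prodP AO; apply/open_prodP => x y /AO[U [V [? ? ? ? ?]]].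
by exists U, V; split => //; [exact: fX|exact: fY].
Qed.

Lemma polish_base (R : realType) (T : topologicalType) : polish R T ->
  exists W : nat -> set T, (forall n, open (W n)) /\
    forall x U, open U -> U x -> exists2 n, W n x & W n `<=` U.
Proof.
move=> [sT /completely_metrizableP[d [hd oE _]]].
have [W [_ oW Wb]] := separable_regular_basis sT hd oE.
exists W; split => // x U oU Ux.
have [n [Wx WU _]] := Wb 1 x U ltr01 oU Ux.
by exists n => // y Wy; apply: WU; exact: subset_closure.
Qed.

(** By second countability it suffices to choose, for each basic [W n], one clopen set between [W n]
    and [U], if there is any. *)
Lemma zpolish_open_bigcup (R : realType) (T : topologicalType) (U : set T) :
  zpolish R T -> open U ->
  exists2 K : nat -> set T, forall n, clopen (K n) & U = \bigcup_n K n.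
Proof.
move=> [/polish_base[W [oW Wb]] [_ cb]] oU.
have KP n : exists K : set T, [/\ clopen K, K `<=` U &
    forall C, clopen C -> C `<=` U -> W n `<=` C -> W n `<=` K].
  have [[C [cC CU WC]]|nC] := pselect (exists C, [/\ clopen C, C `<=` U & W n `<=` C]).
    by exists C.
  exists set0; split => //; first by split; [exact: open0|exact: closed0].
  by move=> C cC CU WC; case: nC; exists C.
have [K KU] := choice KP; exists K; first by move=> n; have [] := KU n.
apply/seteqP; split=> [x Ux|x [n _]]; last by have [_ + _] := KU n; exact.
have [|C [cC Cx] CU] := cb x U; first exact: open_nbhs_nbhs.
have [n Wx WC] := Wb x C cC.1 Cx.
by exists n => //; have [_ _ /(_ C cC CU WC)] := KU n; exact.
Qed.

Section prod_dist.
Context (R : realType) (S T : Type) (d : S -> S -> R) (d' : T -> T -> R).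

Definition prod_dist (p q : S * T) : R := Num.max (d p.1 q.1) (d' p.2 q.2).

Lemma prod_is_dist : is_dist d -> is_dist d' -> is_dist prod_dist.
Proof.
have ge0 (U : Type) (e : U -> U -> R) x y : is_dist e -> 0 <= e x y.
  move=> he; rewrite -(@pmulrn_lge0 _ _ 2)// -(distxx he x).
  by rewrite (le_trans (dist_triangle he y _ _))// (distC he y x) -mulr2n.
move=> hd hd'; split=> [[x y]|[x y] [x' y']|[x y] [x' y']|[x2 y2] [x y] [x' y']].
- by rewrite /prod_dist/= (distxx hd) (distxx hd') maxxx.
- rewrite /prod_dist/= => h.
  have le0 : d x x' <= 0 /\ d' y y' <= 0 by apply/andP; rewrite -ge_max h.
  congr pair; [apply: (dist_eq0 hd)|apply: (dist_eq0 hd')];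
    by apply/eqP; rewrite eq_le ge0//; case: le0 => lex ley; rewrite ?lex ?ley.
- by rewrite /prod_dist/= (distC hd) (distC hd').
- rewrite /prod_dist/= ge_max; apply/andP; split.
    apply: (le_trans (dist_triangle hd x2 _ _)).
    by rewrite lerD// le_max lexx.
  apply: (le_trans (dist_triangle hd' y2 _ _)).
  by rewrite lerD// le_max lexx orbT.
Qed.

End prod_dist.

Lemma prod_completely_metrizable (R : realType) (S T : topologicalType) :
  completely_metrizable R S -> completely_metrizable R T ->
  completely_metrizable R (S * T)%type.
Proof.
move=> /completely_metrizableP[d [hd oE cd]].
move=> /completely_metrizableP[d' [hd' oE' cd']].
apply/completely_metrizableP; exists (prod_dist d d'); split.
- exact: prod_is_dist.
- apply/funext => A; apply/propext; split.
    move=> /open_prodP AO [x y] /AO[U [V []]].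
    rewrite oE oE' => oU oV Ux Vy UVA.
    have [e e0 eU] := oU x Ux; have [e' e'0 eV] := oV y Vy.
    exists (Num.min e e'); first by rewrite lt_min e0.
    move=> [x' y']; rewrite gt_max !lt_min => /andP[/andP[xx _] /andP[_ yy]].
    by apply: UVA; split; [exact: eU|exact: eV].
  move=> AO; apply/open_prodP => x y Axy; have [e e0 eA] := AO _ Axy.
  exists [set x' | d x x' < e], [set y' | d' y y' < e]; split.
  + by rewrite oE; exact: dist_open_ball.
  + by rewrite oE'; exact: dist_open_ball.
  + by rewrite /= (distxx hd).
  + by rewrite /= (distxx hd').
  + by move=> [x' y'] [/= xx yy]; apply: eA; rewrite gt_max xx.
- move=> F PF FC.
  have [e e0|x Fx] := cd (fst @ F) (fmap_proper_filter fst PF).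
    have [[x y] Fxy] := FC e e0; exists x; apply: (@filterS _ F) Fxy => -[x' y'] /=.
    by rewrite gt_max => /andP[].
  have [e e0|y Fy] := cd' (snd @ F) (fmap_proper_filter snd PF).
    have [[x' y'] Fxy] := FC e e0; exists y'; apply: (@filterS _ F) Fxy => -[? ?] /=.
    by rewrite gt_max => /andP[].
  exists (x, y) => e e0.
  apply: (@filterS _ F) (@filterI _ F PF _ _ (Fx e e0) (Fy e e0)).
  by move=> [x' y'] [/= xx yy]; rewrite gt_max xx.
Qed.

Lemma prod_zpolish (R : realType) (S T : topologicalType) :
  zpolish R S -> zpolish R T -> zpolish R (S * T)%type.
Proof.
move=> [[[D cD dD] mS] [_ bS]] [[[E cE dE] mT] [_ bT]]; split; [split|].
- exists (D `*` E).
    have := bigcup_countable (F := fun x => [set (x, y) | y in E]) cD.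
    move=> h; have {h} : countable (\bigcup_(x in D) [set (x, y) | y in E]).
      by apply: h => x _; exact: sub_countable (card_image_le _ _) cE.
    apply: sub_countable; apply: subset_card_le => -[x y] [/= Dx Ey].
    by exists x => //; exists y.
  move=> W [[x y] Wxy] /open_prodP/(_ x y Wxy)[U [V [oU oV Ux Vy UVW]]].
  have [a [Ua Da]] := dD U (ex_intro _ x Ux) oU.
  have [b [Vb Eb]] := dE V (ex_intro _ y Vy) oV.
  by exists (a, b); split => //; exact: UVW.
- exact: prod_completely_metrizable.
- split=> [A []//|[x y] W]; rewrite nbhsE => -[W' [oW Wxy] WW].
  move/open_prodP: oW => /(_ x y Wxy)[U [V [oU oV Ux Vy UVW]]].
  have [|C [[oC cC] Cx] CU] := bS x U; first exact: open_nbhs_nbhs.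
  have [|C' [[oC' cC'] Cy] CV] := bT y V; first exact: open_nbhs_nbhs.
  exists (C `*` C').
    split; last by [].
    split; first by apply/open_prodP => a b [Ca Cb]; exists C, C'; split.
    rewrite -openC; apply/open_prodP => a b nC.
    have [Ca|nCa] := pselect (C a); last first.
      exists (~` C), setT; split=> //; [by rewrite openC|exact: openT|].
      by move=> [? ?] [/= + _] [].
    exists setT, (~` C'); split=> //; [exact: openT|by rewrite openC| |].
      by move=> Cb; apply: nC.
    by move=> [? ?] [/= _ +] [].
  by move=> [a b] [/= /CU Ua /CV Vb]; apply/WW/UVW.
Qed.

Lemma open_borel (T : topologicalType) : @open T `<=` @borel T.
Proof. exact: sub_sigma_algebra. Qed.

Lemma borel_set0 (T : topologicalType) : borel (set0 : set T).
Proof. by apply: open_borel; exact: open0. Qed.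

Lemma borel_setC (T : topologicalType) (A : set T) : borel A -> borel (~` A).
Proof.
by move=> bA; have [_ + _] := smallest_sigma_algebra setT (@open T);
  rewrite -setTD; exact.
Qed.

Lemma borel_bigcup (T : topologicalType) (A : nat -> set T) :
  (forall n, borel (A n)) -> borel (\bigcup_n A n).
Proof. by have [_ _ +] := smallest_sigma_algebra setT (@open T); exact. Qed.

Lemma borel_preimage (S T : topologicalType) (f : S -> T) (B : set T) :
  continuous f -> borel B -> borel (f @^-1` B).
Proof.
move=> /continuousP cf; pose good (A : set T) := borel (f @^-1` A).
suff : @borel T `<=` good by exact.
apply: smallest_sub => [|A /cf]; last exact: open_borel.
split=> [|A|A gA].
- by rewrite /good preimage_set0; exact: borel_set0.
- by rewrite setTD /good preimage_setC; exact: borel_setC.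
- by rewrite /good preimage_bigcup; exact: borel_bigcup.
Qed.

Lemma borel_horizontal_section (X Y : topologicalType) (A : set (X * Y)) y :
  borel A -> borel [set x | A (x, y)].
Proof.
apply: borel_preimage => x; apply: cvg_pair; [exact: cvg_id|exact: cvg_cst].
Qed.

(** The vertical side of a rectangle inside [A] lies in a section, so the basic sets inside that
    side are countable. *)
Lemma open_countable_projection (R : realType) (X Y : topologicalType)
    (A : set (X * Y)) :
  polish R Y -> open A -> (forall x, countable (xsection A x)) ->
  countable (snd @` A).
Proof.
move=> /polish_base[W [oW Wb]] /open_prodP oA cA.
have : countable (\bigcup_(n in [set n | countable (W n)]) W n).
  by apply: bigcup_countable => //; exact: countableP.
apply: sub_countable; apply: subset_card_le => _ [[x y] Axy <-] /=.
have [U [V [oU oV Ux Vy UVA]]] := oA x y Axy.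
have [n Wy WV] := Wb y V oV Vy; exists n => //=.
apply: sub_countable (cA x); apply: subset_card_le => z /WV Vz.
by rewrite /xsection/= inE; apply: UVA.
Qed.

(** [A] is the union of the rectangles with sides [B n] and [C n], where [C n] is a point of the
    projection or empty, and [B n] is the corresponding horizontal section. *)
Lemma countable_projection_clopen (R : realType) (X Y : topologicalType)
    (A : set (X * Y)) :
  polish R X -> polish R Y -> (forall y, borel [set x | A (x, y)]) ->
  countable (snd @` A) ->
  exists (s : Topological X) (t : Topological Y),
    let X' := @Topological.Pack X s in let Y' := @Topological.Pack Y t in
    [/\ zpolish R X', @open X `<=` @open X',
        zpolish R Y', @open Y `<=` @open Y' & @clopen (X' * Y')%type A].
Proof.
move=> pX pY bA /countable_injP[f fI].
pose B n := [set x | exists y, A (x, y) /\ f y = n].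
pose C n := [set y | (snd @` A) y /\ f y = n].
have fA y y' : (snd @` A) y -> (snd @` A) y' -> f y = f y' -> y = y'.
  by move=> Ay Ay' /fI; rewrite !inE; exact.
have bB n : borel (B n).
  have [[y [Ay yn]]|nB] := pselect (exists y, C n y); last first.
    suff -> : B n = set0 by exact: borel_set0.
    apply/seteqP; split=> // x [y [Axy yn]]; apply: nB; exists y; split => //.
    by exists (x, y).
  suff -> : B n = [set x | A (x, y)] by [].
  apply/seteqP; split=> [x [y' [Axy yn']]|x Axy]; last by exists y.
  suff <- : y' = y by [].
  by apply: fA => //; [exists (x, y')|rewrite yn'].
have bC n : borel (C n).
  have [[y Cy]|nC] := pselect (exists y, C n y); last first.
    suff -> : C n = set0 by exact: borel_set0.
    by apply/seteqP; split=> // y Cy; apply: nC; exists y.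
  suff -> : C n = [set y].
    rewrite -[X in borel X]setCK; apply: borel_setC; apply: open_borel; rewrite openC.
    apply/accessible_closed_set1/hausdorff_accessible.
    exact: completely_metrizable_hausdorff pY.2.
  apply/seteqP; split=> [y' [Ay' yn']|_ ->//].
  by case: Cy => Ay yn; apply: fA => //; rewrite yn.
have [s [zX fX cB]] := zpolish_refinement pX bB.
(* Index 0 makes the whole projection clopen; the sets [C k] are shifted by one. *)
have [t [zY fY cC]] := zpolish_refinement pY
  (B := fun n => if n is k.+1 then C k else \bigcup_k C k)
  (fun n => (if n is k.+1 return borel (if n is k.+1 then C k else \bigcup_k C k)
             then bC k else borel_bigcup bC)).
exists s, t; split=> //; split; rewrite -?openC; apply/open_prodP => x y Axy.
  exists (B (f y)), (C (f y)); split.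
  - exact: (cB _).1.
  - exact: (cC (f y).+1).1.
  - by exists y.
  - by split => //; exists (x, y).
  - move=> [x' y'] [/= [y2 [Axy2 y2y]] [Ay' y'y]].
    suff -> : y' = y2 by [].
    by apply: fA => //; [exists (x', y2)|rewrite y2y].
(* Openness of the complement: over a point of the projection only its section has to be avoided,
   and elsewhere the complement of the projection is available. *)
have [[[x' y'] Axy' /= yy]|nAy] := pselect ((snd @` A) y).
  exists (~` B (f y)), (C (f y)); split.
  - by rewrite openC; exact: (cB _).2.
  - exact: (cC (f y).+1).1.
  - move=> [y2 [Axy2 y2y]]; apply: Axy; suff -> : y = y2 by [].
    by apply: fA => //; [exists (x', y')|exists (x, y2)].
  - by split => //; exists (x', y').
  - move=> [a b] [/= nBa [_ bE]] Aab; apply: nBa; exists b; split => //.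
exists setT, (~` \bigcup_k C k); split => //.
- exact: openT.
- by rewrite openC; exact: (cC 0%N).2.
- by move=> [k _ [Ay _]].
- move=> [a b] [_ nCb] Aab; apply: nCb; exists (f b) => //; split => //.
  by exists (a, b).
Qed.

(** * Differences of open sets *)

(** A nested difference, suited to induction on [m]; for increasing sequences of open sets [DdiffP]
    relates it to [Ddiff]. *)
Fixpoint alt_diff (T : Type) (U : nat -> set T) (m : nat) : set T :=
  if m is n.+1 then U n `\` alt_diff U n else set0.

Lemma eq_alt_diff (T : Type) (U V : nat -> set T) m :
  (forall i, (i < m)%N -> U i = V i) -> alt_diff U m = alt_diff V m.
Proof.
elim: m => //= m IHm UV; rewrite UV// IHm// => i im.
by rewrite UV// ltnS ltnW.
Qed.

Lemma preimage_alt_diff (S T : Type) (f : S -> T) (U : nat -> set T) m :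
  f @^-1` alt_diff U m = alt_diff (fun n => f @^-1` U n) m.
Proof. by elim: m => //= m <-. Qed.

(** In an increasing sequence only the first set containing [x] matters: each later difference flips
    membership. *)
Lemma alt_diff_first (T : Type) (U : nat -> set T) (j m : nat) (x : T) :
  (forall i k, (i <= k)%N -> U i `<=` U k) ->
  U j x -> (forall i, (i < j)%N -> ~ U i x) ->
  alt_diff U m x <-> (j < m)%N /\ odd j != odd m.
Proof.
move=> mU Ux nU; elim: m => [|m IHm] /=; first by split=> // -[].
have Um : U m x <-> (j <= m)%N.
  split=> [Umx|jm]; last exact: mU Ux.
  by rewrite leqNgt; apply/negP => /nU.
rewrite ltnS; split=> [[/Um jm nD]|[jm jmE]].
  split=> //; apply/eqP => jE; apply: nD; apply/IHm.
  split; last by rewrite jE/=; case: odd.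
  by rewrite ltn_neqAle jm andbT; apply/eqP => jE'; move: jE; rewrite jE'/=; case: odd.
split; first exact/Um.
by move=> /IHm[_]; move: jmE; rewrite /=; do 2 case: odd.
Qed.

Lemma alt_diff_exists (T : Type) (U : nat -> set T) (m : nat) (x : T) :
  alt_diff U m x -> exists j, U j x /\ forall i, (i < j)%N -> ~ U i x.
Proof.
case: m => // m [Umx _]; case: (firstP (U ^~ x)) => [/(_ m)//|j Uj nU].
by exists j.
Qed.

Lemma DdiffP (T : topologicalType) (m : nat) (A : set T) :
  Ddiff m A <-> exists U : nat -> set T, [/\ forall n, open (U n),
    forall i j, (i <= j)%N -> U i `<=` U j & A = alt_diff U m].
Proof.
split=> [[U [oU mU ->]]|[U [oU mU ->]]].
  (* From index [m] on, the whole space continues the sequence and keeps it increasing. *)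
  pose V n := if insub n is Some i then U i else setT.
  have VE (i : 'I_m) : V i = U i by rewrite /V valK.
  have oV n : open (V n).
    by rewrite /V; case: insubP => [i _ _|_]; [exact: oU|exact: openT].
  have mV i j : (i <= j)%N -> V i `<=` V j.
    rewrite /V => ij; case: (insubP _ j) => [j' _ jj'|_]; last exact: subsetT.
    case: insubP => [i' _ ii'|]; first by apply: mU; rewrite ii' jj'.
    by rewrite -leqNgt => mi; have := ltn_ord j'; rewrite ltnNge jj' (leq_trans mi).
  exists V; split => //; apply/seteqP; split=> [x [j /= jm [Ujx nU]]|x Vx].
    apply/(@alt_diff_first _ V j) => //; rewrite ?VE// => i ij Vix.
    have im : (i < m)%N by exact: ltn_trans (ltn_ord j).
    by apply: nU; exists (Ordinal im) => //; rewrite -VE.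
  have [j [Vj nV]] := alt_diff_exists Vx.
  have [/(_ Vx)[jm jmE] _] := alt_diff_first m mV Vj nV.
  exists (Ordinal jm) => //=; split; first by rewrite -VE.
  by move=> [i /= ij]; rewrite -VE; exact: nV.
exists (fun i => U i); split=> //; first by move=> i j; exact: mU.
apply/seteqP; split=> [x Ux|x [j /= jm [Ujx nU]]].
  have [j [Uj nU]] := alt_diff_exists Ux.
  have [/(_ Ux)[jm jmE] _] := alt_diff_first m mU Uj nU.
  by exists (Ordinal jm) => //=; split => // -[i /= ij]; exact: nU.
apply/(@alt_diff_first _ U j) => // i ij Uix; apply: nU.
by exists (Ordinal (ltn_trans ij (ltn_ord j))).
Qed.

Lemma Ddiff_preimage (S T : topologicalType) (f : S -> T) m (A : set T) :
  continuous f -> Ddiff m A -> Ddiff m (f @^-1` A).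
Proof.
move=> /continuousP cf /DdiffP[U [oU mU ->]].
apply/DdiffP; exists (fun n => f @^-1` U n); split=> [n|i j ij x|].
- exact: cf.
- exact: mU.
- exact: preimage_alt_diff.
Qed.

Lemma borel_setU (T : topologicalType) (A B : set T) :
  borel A -> borel B -> borel (A `|` B).
Proof.
move=> bA bB; rewrite -bigcup2E; apply: borel_bigcup => -[//|[//|n]] /=.
exact: borel_set0.
Qed.

Lemma borel_setD (T : topologicalType) (A B : set T) :
  borel A -> borel B -> borel (A `\` B).
Proof.
move=> bA bB; rewrite setDE -[A]setCK -setCU.
exact: borel_setC (borel_setU (borel_setC bA) bB).
Qed.

Lemma borel_Ddiff (T : topologicalType) m (A : set T) : Ddiff m A -> borel A.
Proof.
move=> /DdiffP[U [oU _ ->]]; elim: m => [|m IHm] /=.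
  exact: borel_set0.
exact: borel_setD (open_borel (oU m)) IHm.
Qed.

(* A concrete description of the successor of [D_m]. *)
Definition Ddiff_succ (m : nat) : set_class := fun P A =>
  exists C B B' : set P, [/\ clopen C, Ddiff m B, Ddiff m B' &
    A = (C `&` B) `|` (~` C `\` B')].

Lemma Ddiff_succ_setC (T : topologicalType) m (A : set T) :
  Ddiff_succ m A -> Ddiff_succ m (~` A).
Proof.
move=> [C [B [B' [cC DB DB' ->]]]]; exists (~` C), B', B; split => //.
  exact: clopenC.
apply/seteqP; split=> x /=; have [Cx|nCx] := pselect (C x);
  have [Bx|nBx] := pselect (B x); by have [B'x|nB'x] := pselect (B' x); tauto.
Qed.

Lemma Ddiff_sub_succ (T : topologicalType) m (A : set T) :
  Ddiff m A -> Ddiff_succ m A.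
Proof.
move=> DA; exists setT, A, A; split=> //; first exact: clopenT.
by rewrite setTI setCT set0D setU0.
Qed.

(** On [C] an empty first set is added, which changes nothing; outside [C] the whole space is added
    as last set, which takes the complement. *)
Lemma Ddiff_succ_sub (T : topologicalType) m (A : set T) :
  Ddiff_succ m A -> Ddiff m.+1 A.
Proof.
move=> [C [B [B' [[oC cC] /DdiffP[U [oU mU BE]] /DdiffP[V [oV mV B'E]] ->]]]].
pose U' n := if n is k.+1 then U k else set0.
pose V' n := if (n < m)%N then V n else setT.
apply/DdiffP; exists (fun n => (C `&` U' n) `|` (~` C `&` V' n)); split.
- move=> n; apply: openU; apply: openI => //.
  + by case: n => //=; exact: open0.
  + by rewrite openC.
  + by rewrite /V'; case: ifP => // _; exact: openT.
- move=> i j ij x [[Cx Ux]|[Cx Vx]]; [left|right]; split => //.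
    by case: i j ij Ux => // i [//|j] ij; exact: mU.
  move: Vx; rewrite /V'; case: (ltnP j m) => // jm.
  by rewrite (leq_ltn_trans ij jm); exact: mV.
- have glue n : alt_diff (fun n => (C `&` U' n) `|` (~` C `&` V' n)) n =
      (C `&` alt_diff U' n) `|` (~` C `&` alt_diff V' n).
    elim: n => [|n /= ->]; first by rewrite /= !setI0 setU0.
    apply/seteqP; split=> x /=; have [Cx|nCx] := pselect (C x); tauto.
  have shift n : alt_diff U' n.+1 = alt_diff U n.
    by elim: n => [|n IHn]; [rewrite /= set0D|rewrite [LHS]/= -/(alt_diff U' n.+1) IHn].
  rewrite glue shift BE B'E setDE; congr (_ `|` (_ `&` _)).
  rewrite /= /V' ltnn setTD; congr (~` _); apply: eq_alt_diff => i im.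
  by rewrite im.
Qed.

Lemma Ddiff_succ_preimage (S T : topologicalType) (f : S -> T) m (A : set T) :
  continuous f -> Ddiff_succ m A -> Ddiff_succ m (f @^-1` A).
Proof.
move=> cf [C [B [B' [cC DB DB' ->]]]].
exists (f @^-1` C), (f @^-1` B), (f @^-1` B'); split=> //.
- exact: preimage_clopen.
- exact: Ddiff_preimage.
- exact: Ddiff_preimage.
Qed.

(* The points at which the greedy attempt to write [A] as a difference of [m]
   open sets fails. *)
Fixpoint residue (T : topologicalType) (m : nat) (A : set T) : set T :=
  if m is n.+1 then A `&` closure (residue n (~` A)) else A.

Lemma Ddiff_residue0 (T : topologicalType) m (A : set T) :
  Ddiff m A -> residue m A = set0.
Proof.
move=> /DdiffP[U [oU _ AE]].
(* Localised for the induction: inside [W] and [U m], the complement of [A] is the difference of the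
   first [m] sets. *)
suff loc W x : open W -> W x -> (forall z, W z -> A z <-> alt_diff U m z) ->
    ~ residue m A x.
  by apply/seteqP; split=> // x; apply: (loc setT); [exact: openT|by []|rewrite AE].
elim: m A {AE} W x => [|m IHm] A W x oW Wx AW; first by move=> /AW; exact.
move=> [/AW-/(_ Wx)[Ux _]] /(_ (W `&` U m))[].
  by apply: open_nbhs_nbhs; split; [exact: openI|].
move=> z [rz [Wz Uz]]; apply: IHm rz; first exact: (openI oW (oU m)).
  by [].
move=> a [Wa Ua] /=; split=> [nAa|Da Aa]; last by have [_] := (AW a Wa).1 Aa.
by apply: contrapT => nDa; apply/nAa/AW.
Qed.

(** Greedy choice: [U j] is the complement of the closure of the residue of level [j], and
    [alt_diff U j] is then [S j] minus that residue. The parity in [S] makes [S m] equal to [A]. *)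
Lemma residue0_Ddiff (T : topologicalType) m (A : set T) :
  residue m A = set0 -> Ddiff m A.
Proof.
pose S j := if odd j == odd m then A else ~` A.
have SS j : S j.+1 = ~` S j.
  by rewrite /S /=; case: (odd j); case: (odd m); rewrite //= setCK.
pose U j := ~` closure (residue j (S j)).
have rS j : residue j.+1 (S j.+1) = S j.+1 `\` U j.
  by rewrite /U setDE setCK /= {2}SS setCK.
move=> r0; apply/DdiffP; exists U; split.
- by move=> n; rewrite openC; exact: closed_closure.
- have UU j : U j `<=` U j.+1.
    apply: subsetC; rewrite [X in _ `<=` X](closure_id _).1; last exact: closed_closure.
    by apply: closureS; rewrite rS /U setDE setCK.
  move=> i j; elim: j => [|j IHj]; first by rewrite leqn0 => /eqP ->.
  by rewrite leq_eqVlt => /predU1P[->//|]; rewrite ltnS => /IHj/subset_trans; exact.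
- have UE j : alt_diff U j = S j `\` residue j (S j).
    elim: j => [|j IHj]; first by rewrite /= setDv.
    rewrite rS setDD [LHS]/= IHj; apply/seteqP; split=> x.
      move=> [Ux nSx]; split=> //; rewrite SS => Sx; apply: nSx; split => // rx.
      by apply: Ux; exact: subset_closure.
    by move=> [+ Ux]; rewrite SS => nSx; split => // -[].
  by rewrite UE /S eqxx r0 setD0.
Qed.

(** * Reductions and the successor of [D_m] *)

Lemma continuous_open_nbhs (S T : topologicalType) (f : S -> T) :
  (forall x V, open V -> V (f x) -> \forall z \near x, V (f z)) -> continuous f.
Proof.
move=> fV x A; rewrite nbhsE => -[V [oV Vfx] VA].
by apply: filterS (fV x V oV Vfx) => z /VA.
Qed.

Lemma near_avoid (T : topologicalType) (K : nat -> set T) (x : T) (n : nat) :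
  (forall k, clopen (K k)) -> (forall k, (k < n)%N -> ~ K k x) ->
  \forall z \near x, forall k, (k < n)%N -> ~ K k z.
Proof.
move=> cK; elim: n => [|n IHn] nK; first exact: nearW.
have Kn : \forall z \near x, ~ K n z.
  apply: (@open_nbhs_nbhs _ x (~` K n)); split; last exact: nK.
  by rewrite openC; exact: (cK n).2.
apply: filterS2 Kn (IHn _) => [z nKz zn k|k kn]; last by apply: nK; exact: ltnW.
by rewrite ltnS leq_eqVlt => /predU1P[->//|]; exact: zn.
Qed.

(** The complement of [U m] is sent to [y]. The pieces of a clopen decomposition of [U m] are sent
    closer and closer to [y], by reductions to the complement of [A] obtained by induction around
    points of its residue. The set [N] is what confines these images. *)
Lemma residue_reduction (R : realType) (P T : topologicalType) m
    (A N : set T) (y : T) (U : nat -> set P) :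
  zpolish R P -> completely_metrizable R T ->
  residue m A y -> open N -> N y -> (forall n, open (U n)) ->
  exists f : P -> T,
    [/\ continuous f, forall x, N (f x) & f @^-1` A = ~` alt_diff U m].
Proof.
move=> zP /completely_metrizableP[d [hd oE _]] + + + oU.
elim: m A N y => [|m IHm] A N y rA oN Ny.
  exists (fun=> y); split=> //; first exact: cst_continuous.
  by rewrite /= setC0; apply/seteqP; split.
have [K cK UE] := zpolish_open_bigcup zP (oU m).
have [Ay cly] := rA.
pose B n := [set z | d y z < n.+1%:R^-1].
have oB n : open (B n) by rewrite oE; exact: dist_open_ball.
have By n : B n y by rewrite /B/= (distxx hd) invr_gt0.
have /choice[g gP] n : exists g : P -> T,
    [/\ continuous g, forall x, (N `&` B n) (g x) &
      g @^-1` (~` A) = ~` alt_diff U m].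
  have oNB := openI oN (oB n).
  have [|z [rz NBz]] := cly (N `&` B n); first by apply: open_nbhs_nbhs.
  exact: (IHm _ _ z).
pose f x := if first (K ^~ x) is n.+1 then g n x else y.
exists f; split.
- apply: continuous_open_nbhs => x V oV; rewrite {1}/f.
  case: firstP => [nK Vy|n Knx nK Vg].
    move: (oV); rewrite oE => /(_ y Vy)[e e0 eV]; have [k ke] := invS_lt e0.
    (* Near a point outside [U m] the first [k] clopen sets are avoided, so the values stay within
       [k.+1%:R^-1] of [y]. *)
    apply: filterS (near_avoid cK (n := k) (fun i _ => nK i)) => z zk.
    rewrite /f; case: firstP => // n Kn _; apply: eV; apply: le_lt_trans ke.
    have [_ /(_ z)[_ /ltW zn] _] := gP n; apply: le_trans zn _.
    rewrite lef_pV2 ?posrE ?ltr0n// ler_nat ltnS leqNgt; apply/negP => /zk.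
    exact.
  have gx : \forall z \near x, V (g n z).
    have [cg _ _] := gP n; apply: cg; exact: open_nbhs_nbhs.
  have Kx : \forall z \near x, K n z.
    by apply: open_nbhs_nbhs; split => //; exact: (cK n).1.
  apply: filterS3 gx Kx (near_avoid cK nK) => z Vz Kz zn.
  by rewrite /f (first_unique Kz zn).
- by move=> x; rewrite /f; case: firstP => // n _ _; have [_ /(_ x)[]] := gP n.
- apply/seteqP; split=> x; rewrite /f /= UE.
    case: firstP => [nK _ [[n _ Kx] _]|n Kn _ Ag [_]]; first exact: nK Kx.
    apply; apply: contrapT => nD; have [_ _ /seteqP[_ /(_ x nD)]] := gP n.
    exact.
  case: firstP => // n Kn _ nD; apply: contrapT => nAg; apply: nD.
  split; first by exists n.
  by move=> Dx; have [_ _ /seteqP[/(_ x nAg) + _]] := gP n; exact.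
Qed.

Lemma dual_Ddiff_reduction (R : realType) (P T : topologicalType) m
    (A : set T) (B : set P) :
  zpolish R P -> completely_metrizable R T -> ~ Ddiff m A -> Ddiff m (~` B) ->
  exists2 f : P -> T, continuous f & B = f @^-1` A.
Proof.
move=> zP mT nA /DdiffP[U [oU _ BE]].
have [y ry] : residue m A !=set0.
  by apply/set0P/eqP => rA; apply: nA; exact: residue0_Ddiff.
have [f [cf _ fA]] := residue_reduction (N := setT) zP mT ry openT I oU.
by exists f => //; rewrite fA -BE setCK.
Qed.

Lemma continuous_clopen_glue (S T : topologicalType) (C : set S) (f g : S -> T) :
  clopen C -> continuous f -> continuous g ->
  exists h : S -> T, [/\ continuous h, forall x, C x -> h x = f x &
    forall x, ~ C x -> h x = g x].
Proof.
move=> [oC cC] cf cg; pose h x := if pselect (C x) then f x else g x.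
have hf x : C x -> h x = f x by rewrite /h; case: pselect.
have hg x : ~ C x -> h x = g x by rewrite /h; case: pselect.
exists h; split => //; apply: continuous_open_nbhs => x V oV.
have [Cx|nCx] := pselect (C x).
  rewrite hf// => Vx; have Cn : \forall z \near x, C z by exact: open_nbhs_nbhs.
  have Vn : \forall z \near x, V (f z) by apply: cf; exact: open_nbhs_nbhs.
  by apply: filterS2 Cn Vn => z Cz Vz; rewrite hf.
rewrite hg// => Vx; have Cn : \forall z \near x, ~ C z.
  by apply: (@open_nbhs_nbhs _ x (~` C)); split; rewrite ?openC.
have Vn : \forall z \near x, V (g z) by apply: cg; exact: open_nbhs_nbhs.
by apply: filterS2 Cn Vn => z Cz Vz; rewrite hg.
Qed.

(** * Complete sets on the Baire space *)

Lemma baire_zpolish (R : realType) : exists s : Topological (nat -> nat),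
  let Q := @Topological.Pack (nat -> nat) s in
  zpolish R Q /\ @open Q = chart_open id.
Proof.
apply: chart_zpolish => [x y xy|z zs]; first exact/funext.
by exists z.
Qed.

Section baire.
Context (R : realType) (s : Topological (nat -> nat)).
Let Q := @Topological.Pack (nat -> nat) s.
Context (zQ : zpolish R Q) (oE : @open Q = chart_open id).

(* The points of supremum [m - j] lie in [top_open m i] exactly for [i >= j],
   and are limits of points of supremum [m - j + 1] when [0 < j]. *)
Let top_open (m j : nat) : set Q := [set z | exists i, (m <= z i + j)%N].
Let top_diff m : set Q := ~` alt_diff (top_open m) m.

Let Ddiff_top_diff m : Ddiff m (~` top_diff m).
Proof.
rewrite setCK; apply/DdiffP; exists (top_open m); split=> // [j|j k jk z].
  rewrite oE => z [i im]; exists [:: i] => y yz; exists i.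
  by rewrite -yz// mem_head.
by move=> [i im]; exists i; rewrite (leq_trans im)// leq_add2l.
Qed.

(** Residues alternate between a set and its complement; the parity makes level [m] the set
    [top_diff m] itself. *)
Let parity_diff m j := if odd j == odd m then top_diff m else ~` top_diff m.

Let parity_diffE m j (z : Q) : (j <= m)%N -> (forall i, (z i <= m - j)%N) ->
  (exists i, z i = (m - j)%N) -> parity_diff m j z.
Proof.
move=> jm zj [i0 zi0].
have mU i k : (i <= k)%N -> top_open m i `<=` top_open m k.
  by move=> ik y [i1 im]; exists i1; rewrite (leq_trans im)// leq_add2l.
have Uj : top_open m j z by exists i0; rewrite zi0 subnK.
have nU i : (i < j)%N -> ~ top_open m i z.
  by move=> ij [i1]; have := zj i1; lia.
have DE := alt_diff_first m mU Uj nU.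
rewrite /parity_diff; case: ifPn => jmE.
  by move=> /DE[_]; rewrite jmE.
apply: contrapT => nD; apply: nD => nD; apply: nD; apply/DE; split => //.
by rewrite ltn_neqAle jm andbT; apply: contra jmE => /eqP ->.
Qed.

Let residue_top_diff m j (z : Q) : (j <= m)%N -> (forall i, (z i <= m - j)%N) ->
  (exists i, z i = (m - j)%N) -> residue j (parity_diff m j) z.
Proof.
elim: j z => [|j IHj] z jm zj ez; first exact: parity_diffE.
split; first exact: parity_diffE.
have -> : ~` parity_diff m j.+1 = parity_diff m j.
  by rewrite /parity_diff /=; case: (odd j); case: (odd m); rewrite //= setCK.
move=> A; rewrite nbhsE => -[V [oV Vz] VA].
move: oV; rewrite oE => /(_ z Vz)[t tV].
(* A coordinate beyond those in [t] is raised to [m - j]: the point stays close to [z] while its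
   supremum grows by one. *)
pose n := (\max_(i <- t) i).+1.
pose y : Q := fun i => if i == n then (m - j)%N else z i.
exists y; split.
  apply: IHj; first exact: ltnW.
    by move=> i; rewrite /y; case: eqP => // _; have := zj i; lia.
  by exists n; rewrite /y eqxx.
apply/VA/tV => i ti; rewrite /y; case: eqP => // iE.
have : (i <= \max_(k <- t) k)%N by exact: leq_bigmax_seq.
by rewrite iE ltnn.
Qed.

Let not_Ddiff_top_diff m : ~ Ddiff m (top_diff m).
Proof.
move=> /Ddiff_residue0 r0.
have : residue m (parity_diff m m) (fun=> 0%N : nat).
  by apply: residue_top_diff => //; exists 0%N; rewrite subnn.
by rewrite /parity_diff eqxx r0.
Qed.

Lemma Ddiff_nonselfdual m : exists2 A : set Q, Ddiff m (~` A) & ~ Ddiff m A.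
Proof. by exists (top_diff m). Qed.

(* The first coordinate selects the side of the clopen partition, and the
   other ones are used as a point of the complete set of the dual class. *)
Lemma Ddiff_succ_complete m : exists A : set Q, Ddiff_succ m A /\
  forall (P : topologicalType) (B : set P), zpolish R P -> Ddiff_succ m B ->
    exists2 f : P -> Q, continuous f & B = f @^-1` A.
Proof.
have ctail : continuous (fun z : Q => (fun i => z i.+1) : Q).
  apply/continuousP => V; rewrite oE => oV z /oV[t tV].
  by exists [seq i.+1 | i <- t] => y yz; apply: tV => i ti; rewrite yz// map_f.
have ccons a : continuous (fun z : Q => (fun i => if i is k.+1 then z k else a) : Q).
  apply/continuousP => V; rewrite oE => oV z /oV[t tV].
  exists [seq i.-1 | i <- t] => y yz; apply: tV => -[//|i] ti.
  by rewrite yz//; apply/mapP; exists i.+1.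
pose C : set Q := [set z | z 0%N = 0%N].
have cC : clopen C.
  split; rewrite -?openC oE => z Cz; exists [:: 0%N] => y yz.
    by rewrite /C/= -yz ?mem_head.
  by rewrite /C/= -yz ?mem_head.
pose D : set Q := [set z | (~` top_diff m) (fun i => z i.+1)].
have DD : Ddiff m D by exact: Ddiff_preimage ctail (Ddiff_top_diff m).
exists ((C `&` D) `|` (~` C `\` D)); split; first by exists C, D, D; split.
move=> P B zP [E [B0 [B1 [cE DB0 DB1 ->]]]].
(* The complement of [top_diff m] is complete for differences of [m] open sets. *)
have red B' : Ddiff m B' ->
    exists2 f : P -> Q, continuous f & B' = f @^-1` (~` top_diff m).
  move=> DB'; rewrite -(setCK B') in DB'.
  have [f cf fE] := dual_Ddiff_reduction zP zQ.1.2 (@not_Ddiff_top_diff m) DB'.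
  by exists f => //; rewrite -[LHS]setCK fE.
have [f0 cf0 B0E] := red _ DB0; have [f1 cf1 B1E] := red _ DB1.
pose cons a (z : Q) : Q := fun i => if i is k.+1 then z k else a.
have [h [ch h0 h1]] := continuous_clopen_glue cE
  (f := cons 0%N \o f0) (g := cons 1%N \o f1)
  (fun x => continuous_comp (@cf0 x) (@ccons _ _))
  (fun x => continuous_comp (@cf1 x) (@ccons _ _)).
exists h => //; rewrite B0E B1E; apply/seteqP; split=> x /=.
  move=> [[Ex Dx]|[Ex Dx]]; [left|right].
    by rewrite h0.
  by rewrite h1.
have [Ex|nEx] := pselect (E x).
  by rewrite h0// => -[[_ ?]|[nC _]]; [left|case: nC].
by rewrite h1// => -[[]//|[_ ?]]; right.
Qed.

End baire.

(** Minimality: a generator of a strictly larger class is not in [Ddiff m], so both sides of a set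
    of [Ddiff_succ m] reduce to it, one by inclusion of classes and the other through a residue
    point. The two reductions are glued along the clopen set. *)
Lemma Ddiff_wadge_successor (R : realType) m :
  wadge_successor R (Ddiff m) (Ddiff_succ m).
Proof.
have [s [zQ oE]] := baire_zpolish R.
have [A0 [sA0 A0P]] := Ddiff_succ_complete zQ oE m.
split; [|split|].
- exists (@Topological.Pack (nat -> nat) s), A0; split=> // [|P A zP].
    exact: borel_Ddiff (Ddiff_succ_sub sA0).
  split=> [/A0P[//|f cf ->]|[f [cf ->]]]; first by exists f.
  exact: Ddiff_succ_preimage.
- by move=> P _ A; exact: Ddiff_sub_succ.
- have [A DA nDA] := Ddiff_nonselfdual oE m.
  move=> /(_ _ zQ A) sub; apply/nDA/sub; rewrite -[A]setCK.
  exact/Ddiff_succ_setC/Ddiff_sub_succ.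
- move=> K [P0 [A1 [zP0 _ KE]]] [DK nKD] P zP B [C [B0 [B1 [cC DB0 DB1 ->]]]].
  have nA1 : ~ Ddiff m A1.
    move=> DA1; apply: nKD => P' zP' A' /(KE _ _ zP')[f [cf ->]].
    exact: Ddiff_preimage.
  have [f [cf B0E]] := (KE P B0 zP).1 (DK _ zP _ DB0).
  have [|g cg B1E] := dual_Ddiff_reduction (B := ~` B1) zP zP0.1.2 nA1.
    by rewrite setCK.
  have [h [ch h0 h1]] := continuous_clopen_glue cC cf cg.
  apply/KE => //; exists h; split=> //; rewrite setDE B0E B1E.
  apply/seteqP; split=> x /=; first by move=> [[Cx]|[nCx]]; [rewrite h0|rewrite h1].
  by have [Cx|nCx] := pselect (C x); [rewrite h0//; left|rewrite h1//; right].
Qed.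

Lemma Ddiff_sub_wadge_succ (R : realType) m (P : topologicalType) (A : set P) :
  Ddiff_succ m A -> wadge_succ R (Ddiff m) A.
Proof. by exists (Ddiff_succ m) => //; exact: Ddiff_wadge_successor. Qed.

Lemma wadge_succ_Ddiff (R : realType) m (P : topologicalType) (A : set P) :
  zpolish R P -> wadge_succ R (Ddiff m) A -> Ddiff_succ m A.
Proof.
move=> zP [H sH HA].
have [HD _] := wadge_successor_unique sH (Ddiff_wadge_successor R m).
exact: HD HA.
Qed.

(* Once [U 0] is clopen it can be merged into [U 1 `\` U 0], which shortens the
   sequence by one. *)
Lemma alt_diff_drop (R : realType) (X Y : topologicalType) (m : nat)
    (U : nat -> set (X * Y)) :
  zpolish R X -> zpolish R Y -> (forall n, open (U n)) ->
  (forall i j, (i <= j)%N -> U i `<=` U j) ->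
  (forall x, countable (xsection (U 0%N) x)) ->
  exists (s : Topological X) (t : Topological Y),
    let X' := @Topological.Pack X s in let Y' := @Topological.Pack Y t in
    [/\ zpolish R X', @open X `<=` @open X',
        zpolish R Y', @open Y `<=` @open Y' &
        @Ddiff m.+1 (X' * Y')%type (alt_diff U m.+2)].
Proof.
move=> zX zY oU mU cU.
have bU y : borel [set x | U 0%N (x, y)].
  by apply: borel_horizontal_section; exact: open_borel.
have cp := open_countable_projection zY.1 (oU 0%N) cU.
have [s [t [zX' fX zY' fY [_ cU0]]]] := countable_projection_clopen zX.1 zY.1 bU cp.
exists s, t; split=> //.
pose V n := if n is k.+1 then U k.+2 else U 1%N `\` U 0%N.
apply/DdiffP; exists V; split=> [[|n]|[|i] [|j]|].
- rewrite /V setDE; apply: openI; last by rewrite openC.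
  exact: open_prod_finer fX fY (oU _).
- exact: open_prod_finer fX fY (oU _).
- by move=> _.
- by move=> _ x [Ux _]; exact: mU Ux.
- by [].
- by move=> ij; exact: mU.
- elim: m => [|m IHm]; first by rewrite /= !setD0.
  by rewrite [LHS]/= -[_ `\` (_ `\` alt_diff U m)]/(alt_diff U m.+2) IHm.
Qed.

(** * Potential classes *)

Section potential.
Context (R : realType) (X Y : topologicalType) (A : set (X * Y)).

Lemma pot_sub (G H : set_class) :
  (forall (P : topologicalType) (B : set P), zpolish R P -> G P B -> H P B) ->
  pot R G A -> pot R H A.
Proof.
move=> GH [s [t [zX fX zY fY GA]]]; exists s, t; split => //.
by apply: GH GA; exact: prod_zpolish.
Qed.

Context (cA : forall x, countable (xsection A x)).

Lemma alt_diff_sub_countable (U : nat -> set (X * Y)) :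
  U 0%N `<=` A -> forall x, countable (xsection (U 0%N) x).
Proof.
move=> UA x; apply: sub_countable (cA x); apply: subset_card_le => y.
by rewrite /xsection/= !inE; exact: UA.
Qed.

(** Index 0 has the parity of [m.+2], so [U 0] misses the difference, which is the complement of
    [A]; hence [U 0] lies inside [A]. *)
Lemma pot_dual_Ddiff_drop m : ~~ odd m ->
  pot R (dual (Ddiff m.+2)) A -> pot R (dual (Ddiff m.+1)) A.
Proof.
move=> em [s [t [zX fX zY fY /DdiffP[U [oU mU AE]]]]].
have [|s' [t' [zX' fX' zY' fY' DA]]] := alt_diff_drop m zX zY oU mU.
  apply: alt_diff_sub_countable => x U0; apply: contrapT.
  move=> nAx; have : alt_diff U m.+2 x by rewrite -AE.
  by move=> /(alt_diff_first _ mU U0)[]// _; rewrite /= negbK (negbTE em).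
exists s', t'; split=> //; [exact: subset_trans fX'|exact: subset_trans fY'|].
by rewrite /dual AE.
Qed.

(** Index 0 now has the parity opposite to that of [m.+2], so [U 0] is part of the difference, which
    is [A] itself. *)
Lemma pot_Ddiff_drop m : odd m ->
  pot R (Ddiff m.+2) A -> pot R (Ddiff m.+1) A.
Proof.
move=> om [s [t [zX fX zY fY /DdiffP[U [oU mU AE]]]]].
have [|s' [t' [zX' fX' zY' fY' DA]]] := alt_diff_drop m zX zY oU mU.
  apply: alt_diff_sub_countable => x U0.
  by rewrite AE; apply/(alt_diff_first _ mU U0) => //; rewrite /= negbK om.
exists s', t'; split=> //; [exact: subset_trans fX'|exact: subset_trans fY'|].
by rewrite AE.
Qed.

End potential.

Theorem proposition2p3 (R : realType) (X Y : topologicalType)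
    (hX : polish R X) (hY : polish R Y) (A : set (X * Y)) (hA : borel A)
    (hsec : forall x : X, countable (xsection A x))
    (k : nat) (hk : (0 < k)%N) :
  (* (a) *)
  ((~ pot R Delta01 A <-> ~ pot R Sigma01 A) /\
   (~ pot R Sigma01 A <-> ~ countable (snd @` A))) /\
  (* (b) *)
  ((~ pot R (dual (Ddiff (2 * k - 1))) A <-> ~ pot R (dual (Ddiff (2 * k))) A) /\
   (~ pot R (dual (Ddiff (2 * k))) A <->
    ~ pot R (wadge_succ R (Ddiff (2 * k - 1))) A)) /\
  (* (c) *)
  ((~ pot R (Ddiff (2 * k + 1)) A <-> ~ pot R (Ddiff (2 * k)) A) /\
   (~ pot R (Ddiff (2 * k)) A <-> ~ pot R (wadge_succ R (Ddiff (2 * k))) A)).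
Proof.
(* The equivalences of negations are reduced to cycles of implications between the positive
   statements. *)
have cycle (P Q S : Prop) : (P -> Q) -> (Q -> S) -> (S -> P) ->
  (~ P <-> ~ Q) /\ (~ Q <-> ~ S) by tauto.
have cycle' (P Q S : Prop) : (P -> S) -> (S -> Q) -> (Q -> P) ->
  (~ P <-> ~ Q) /\ (~ Q <-> ~ S) by tauto.
case: k hk => // k _; split; [|split].
- apply: cycle.
  + by apply: pot_sub => P B _ [].
  + move=> [s [t [_ _ [pY _] _ oA]]]; exact: open_countable_projection pY oA hsec.
  + move=> /(countable_projection_clopen hX hY).
    by apply=> y; exact: borel_horizontal_section.
- have -> : (2 * k.+1 - 1 = (2 * k).+1)%N by lia.
  have -> : (2 * k.+1 = (2 * k).+2)%N by lia.
  apply: cycle'.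
  + apply: pot_sub => P B _ DB; apply: Ddiff_sub_wadge_succ.
    by rewrite -[B]setCK; exact/Ddiff_succ_setC/Ddiff_sub_succ.
  (* The successor is closed under complements and lies in the next difference class, hence also in
     its dual. *)
  + apply: pot_sub => P B zP /(wadge_succ_Ddiff zP)/Ddiff_succ_setC.
    exact: Ddiff_succ_sub.
  + by apply: pot_dual_Ddiff_drop => //; rewrite mul2n odd_double.
- have -> : (2 * k.+1 + 1 = (2 * k).+3)%N by lia.
  have -> : (2 * k.+1 = (2 * k).+2)%N by lia.
  have drop : pot R (Ddiff (2 * k).+3) A -> pot R (Ddiff (2 * k).+2) A.
    by apply: pot_Ddiff_drop => //; rewrite /= mul2n odd_double.
  have up : pot R (Ddiff (2 * k).+2) A -> pot R (wadge_succ R (Ddiff (2 * k).+2)) A.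
    apply: pot_sub => P B _ DB; apply: Ddiff_sub_wadge_succ.
    exact: Ddiff_sub_succ.
  have down : pot R (wadge_succ R (Ddiff (2 * k).+2)) A -> pot R (Ddiff (2 * k).+3) A.
    by apply: pot_sub => P B zP /(wadge_succ_Ddiff zP)/Ddiff_succ_sub.
  tauto.
Qed.
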